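(* Let $k\ge 2$ be an integer and let $G$ be a finite simple connected graph of order $n\ge k$. Then $$k\le \mu_{tsp,k}(G)\le \frac{2(k-1)}{k+1}(n+1),$$ equivalently $W_{tsp,k}(K_n)\le W_{tsp,k}(G)\le W_{tsp,k}(P_n)$. Equality in the upper bound holds if and only if $G$ is the path $P_n$, or $k=n$ and $G$ is a tree. Equality in the lower bound holds if and only if for every set $S$ of $k$ vertices of $G$, the induced subgraph $G[S]$ contains a spanning cycle $C_k$ (i.e. $G[S]$ is Hamiltonian).
   Context: For a set $S$ of $k$ vertices, $\mathrm{tsp}_k(S)$ is the length (number of edge traversals, with multiplicity) of a shortest closed walk in $G$ visiting all vertices of $S$; $W_{tsp,k}(G)=\sum_{S\subseteq V,\,|S|=k}\mathrm{tsp}_k(S)$ and $\mu_{tsp,k}(G)=W_{tsp,k}(G)/\binom{n}{k}$. $K_n$ is the complete graph and $P_n$ the path on $n$ vertices. *)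

(* Defs.v *)
From mathcomp Require Import all_boot all_order all_algebra.
From Stdlib Require Import ClassicalEpsilon.
Set Implicit Arguments. Unset Strict Implicit. Unset Printing Implicit Defensive.

Section Graphs.
Variable T : finType.
Variable e : rel T.

Definition simple_graph := symmetric e /\ irreflexive e.
Definition connected_graph := forall x y : T, connect e x y.

(* a closed walk of length m is a cyclic sequence of m vertices
   (x_0, ..., x_{m-1}) with x_i ~ x_{i+1} and x_{m-1} ~ x_0: m edge traversals *)
Definition closed_walk (w : seq T) := cycle e w.

Definition tsp_walk_of_len (S : {set T}) : pred nat :=
  fun m => [exists w : m.-tuple T, closed_walk w && (S \subset w)].

(* tsp_k(S) : the minimal length of a closed walk visiting all of S
   (0 by convention if no such walk exists; never happens when connected, |S|>=2) *)
Definition tsp (S : {set T}) : nat :=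
  match excluded_middle_informative (exists m, tsp_walk_of_len S m) with
  | left H => ex_minn H
  | right _ => 0
  end.

Definition W_tsp (k : nat) : nat := \sum_(S : {set T} | #|S| == k) tsp S.

Definition mu_tsp (k : nat) : rat := (W_tsp k)%:R / ('C(#|T|, k))%:R.

Definition acyclic := forall s : seq T, uniq s -> 3 <= size s -> ~~ cycle e s.
Definition is_tree := connected_graph /\ acyclic.

Definition hamiltonian_on (S : {set T}) :=
  exists s : seq T, [/\ uniq s, S =i s & cycle e s].
End Graphs.

Definition Krel (n : nat) : rel 'I_n := fun i j => i != j.
Definition Prel (n : nat) : rel 'I_n := fun i j => (i.+1 == j :> nat) || (j.+1 == i :> nat).

Definition is_path_graph (T : finType) (e : rel T) :=
  exists f : T -> 'I_#|T|, bijective f /\ forall x y, e x y = Prel (f x) (f y).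

(* Main.v *)
(* If B is a connected vertex set and S lies in B, doubling a spanning tree of B gives
   tsp(S) <= 2(|B| - 1).  Peel off a non-cut vertex v of G, and bound the sum over the k-sets
   S of B containing v by peeling further non-cut vertices u: a set S containing both u and v
   costs at most 2(|B| - 1), a set avoiding u lies in B \ u.  By Pascal's rule the total is
   2(k - 1) C(n + 1, k + 1).  On a path tsp(S) is twice the distance between the extremes of S,
   so the same recursion over intervals gives equality.  For k < n, equality excludes a third
   non-cut vertex, since a set through two non-cut vertices avoiding the third has a cheaper
   tour; a graph with only two non-cut vertices is a path.  For k = n, a cycle gives a tour
   shorter than 2(n - 1), while a closed walk in a tree decomposes at repeated vertices. *)
Require Import Defs.
From mathcomp Require Import all_boot all_order all_algebra.
From mathcomp Require Import zify.
From Stdlib Require Import ClassicalEpsilon.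
Import Order.TTheory GRing.Theory Num.Theory.

Set Implicit Arguments.
Unset Strict Implicit.
Unset Printing Implicit Defensive.

(** * Closed walks, connected vertex sets and non-cut vertices *)

Section Tsp.
Variables (T : finType) (e : rel T).
Implicit Types (S A B C : {set T}) (w p : seq T).

Lemma tsp_le S w : cycle e w -> {subset S <= w} -> tsp e S <= size w.
Proof.
move=> ew Sw.
have H : tsp_walk_of_len e S (size w).
  apply/existsP; exists (in_tuple w); rewrite /closed_walk /= ew /=.
  by apply/subsetP=> x /Sw.
rewrite /tsp; case: excluded_middle_informative => // H'.
by case: ex_minnP => m _; apply.
Qed.

Lemma tsp_walk S w : cycle e w -> {subset S <= w} ->
  exists w', [/\ cycle e w', {subset S <= w'} & size w' = tsp e S].
Proof.
move=> ew Sw.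
have H : exists m, tsp_walk_of_len e S m.
  exists (size w); apply/existsP; exists (in_tuple w).
  by rewrite /closed_walk /= ew /=; apply/subsetP=> x /Sw.
rewrite /tsp; case: excluded_middle_informative => // H'.
case: ex_minnP => m /existsP [w' /andP[ew' /subsetP Sw']] _.
by exists w'; split=> //; rewrite size_tuple.
Qed.

(** A closed path lists its base point [x] at both ends, a cyclic sequence only once. Dropping the
    final entry makes the size the number of edges. *)
Lemma cycle_of_path x p : path e x p -> last x p = x -> 0 < size p ->
  exists w, [/\ cycle e w, size w = size p & w =i x :: p].
Proof.
case/lastP: p => // p z; rewrite last_rcons => ep zx _; subst z.
exists (x :: p); split=> //=; first by rewrite size_rcons.
by move=> y; rewrite !inE mem_rcons inE orbA orbb.
Qed.

(* [B] induces a connected subgraph: every cut of [B] is crossed by an edge. *)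
Definition cut_connected B := forall C, C != set0 -> C \proper B ->
  exists x y, [/\ x \in C, y \in B :\: C & e x y].

Hypothesis esym : symmetric e.

Lemma cut_connected1 x : cut_connected [set x].
Proof.
move=> C C0 pC; move: (proper_card pC); rewrite cards1 ltnS leqn0 cards_eq0.
by rewrite (negPf C0).
Qed.

(** A cut [C] of the union that splits [A] or [B] is crossed inside that set. Otherwise it contains
    one of them and misses the other, and the edge [a b] crosses it. *)
Lemma cut_connectedU A B a b : cut_connected A -> cut_connected B ->
  a \in A -> b \in B -> e a b -> cut_connected (A :|: B).
Proof.
move=> cA cB aA bB eab C C0 pC.
have cross D : cut_connected D -> D \subset A :|: B -> D :&: C != set0 ->
    ~~ (D \subset C) ->
    exists x y, [/\ x \in C, y \in (A :|: B) :\: C & e x y].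
  move=> cD DAB DC0 nDC.
  have pD : D :&: C \proper D by rewrite properE subsetIl subsetI subxx.
  have [x [y []]] := cD _ DC0 pD.
  rewrite !inE => /andP[xD xC] /andP[]; move=> yC yD exy.
  exists x, y; split=> //; rewrite inE (subsetP DAB) // andbT.
  by apply: contra yC => ->; rewrite yD.
have out D z : D :&: C = set0 -> z \in D -> z \notin C.
  by move=> DC0 zD; apply/negP=> zC; have := in_set0 z; rewrite -DC0 inE zD zC.
have [A0|A0] := eqVneq (A :&: C) set0; have [B0|B0] := eqVneq (B :&: C) set0.
- move: C0; rewrite -(setIidPr (proper_sub pC)) setIUl A0 B0 setU0 eqxx //.
- have [BC|nBC] := boolP (B \subset C); last exact: (cross B _ (subsetUr _ _)).
  exists b, a; split; [exact: (subsetP BC)| |by rewrite esym].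
  by rewrite !inE aA andbT (out A).
- have [AC|nAC] := boolP (A \subset C); last exact: (cross A _ (subsetUl _ _)).
  exists a, b; split=> //; first exact: (subsetP AC).
  by rewrite !inE bB orbT andbT (out B).
- have [AC|nAC] := boolP (A \subset C); last exact: (cross A _ (subsetUl _ _)).
  have [BC|nBC] := boolP (B \subset C); last exact: (cross B _ (subsetUr _ _)).
  by move: pC; rewrite properE subUset AC BC andbF.
Qed.

Lemma cut_connected_path x p : path e x p -> cut_connected [set y in x :: p].
Proof.
elim: p x => [|y p IHp] x /=.
  by move=> _; rewrite (_ : finset _ = [set x]); [exact: cut_connected1|
    apply/setP=> z; rewrite !inE].
case/andP=> exy ep.
rewrite (_ : finset _ = [set x] :|: [set z in y :: p]); last first.
  by apply/setP=> z; rewrite !inE.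
apply: (cut_connectedU (@cut_connected1 x) (IHp _ ep) (set11 x) _ exy).
by rewrite !inE eqxx.
Qed.

(** A path from a vertex of [C] to one outside has a first edge leaving [C]. *)
Lemma cut_connected_setT : connected_graph e -> cut_connected setT.
Proof.
move=> ce C /set0Pn[x xC] /properP[_ [y _ yC]].
have /connectP[p] := ce x y.
elim: p x xC => [|z p IHp] x xC /=; first by move=> _ yx; rewrite yx xC in yC.
case/andP=> exz ep yz.
have [zC|zC] := boolP (z \in C); first exact: (IHp z).
by exists x, z; split=> //; rewrite !inE zC.
Qed.

(* Growing [A] inside [B] one vertex at a time, the last vertex added is a non-cut vertex of [B]. *)
Lemma noncut_vertex A B : cut_connected A -> A != set0 -> A \proper B ->
  cut_connected B -> exists u, [/\ u \in B, u \notin A & cut_connected (B :\ u)].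
Proof.
move=> cA A0 pA cB; have [m] := ubnP (#|B| - #|A|).
elim: m A cA A0 pA => // m IHm A cA A0 pA lem.
have [x [y [xA]]] := cB _ A0 pA; rewrite !inE => /andP[yA yB] exy.
have cyA : cut_connected (y |: A).
  by rewrite setUC; apply: (cut_connectedU cA (@cut_connected1 y) xA (set11 y)).
have syA : y |: A \subset B by rewrite subUset sub1set yB proper_sub.
have [E|neq] := eqVneq (y |: A) B.
  by exists y; split=> //; rewrite -E setU1K.
have pyA : y |: A \proper B by rewrite properEneq neq.
have cardyA : #|y |: A| = #|A|.+1 by rewrite cardsU1 yA.
have ltA := proper_card pyA.
case: (IHm (y |: A)) => //; first by apply/set0Pn; exists y; rewrite setU11.
  by lia.
by move=> u [uB]; rewrite !inE negb_or => /andP[_ uA] cBu; exists u.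
Qed.

Lemma noncut_vertex1 B v : cut_connected B -> v \in B -> 1 < #|B| ->
  exists u, [/\ u \in B, u != v & cut_connected (B :\ u)].
Proof.
move=> cB vB lt1B.
have pv : [set v] \proper B.
  by rewrite properEcard sub1set vB cards1.
case: (noncut_vertex (@cut_connected1 v) _ pv cB) => [|u [uB uv cu]].
  by apply/set0Pn; exists v; rewrite set11.
by exists u; split=> //; rewrite inE in uv.
Qed.

(* Each vertex missed by the walk is added by a detour of length two. *)
Lemma extend_closed_walk A B x p : path e x p -> last x p = x ->
  {subset A <= x :: p} -> A != set0 -> A \subset B -> cut_connected B ->
  exists p', [/\ path e x p', last x p' = x, {subset B <= x :: p'}
    & size p' = size p + 2 * (#|B| - #|A|)].
Proof.
move=> ep lp Ap A0 sAB cB; have [m] := ubnP (#|B| - #|A|).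
elim: m A p ep lp Ap A0 sAB => // m IHm A p ep lp Ap A0 sAB lem.
have [E|neq] := eqVneq A B.
  by exists p; split=> //; rewrite -?E // subnn addn0.
have pA : A \proper B by rewrite properEneq neq.
have [b [u [bA]]] := cB _ A0 pA; rewrite !inE => /andP[uA uB] ebu.
have bp := Ap b bA; move: ep lp Ap lem; case/splitPl: bp => p1 p2 lp1.
rewrite cat_path last_cat lp1 => /andP[ep1 ep2] lp2 Ap lem.
have cuA : #|u |: A| = #|A|.+1 by rewrite cardsU1 uA.
have ltA := proper_card pA.
have leB : #|u |: A| <= #|B| by rewrite cuA.
case: (IHm (u |: A) (p1 ++ u :: b :: p2)).
- by rewrite cat_path ep1 lp1 /= ebu esym ebu.
- by rewrite last_cat /=.
- move=> y; rewrite in_setU1 => /predU1P[->|/Ap]; rewrite !(inE, mem_cat).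
    by rewrite eqxx !orbT.
  by case/or3P=> ->; rewrite ?orbT.
- by apply/set0Pn; exists u; rewrite setU11.
- by rewrite subUset sub1set uB.
- by lia.
move=> p' [ep' lp' Bp' sp']; exists p'; split=> //.
by rewrite sp' cuA !size_cat /=; lia.
Qed.

Lemma closed_walk_cut_connected B : cut_connected B -> 1 < #|B| ->
  exists w, [/\ cycle e w, {subset B <= w} & size w = 2 * #|B|.-1].
Proof.
move=> cB lt1B; have /card_gt0P[x xB] : 0 < #|B| by lia.
(* The walk of length 0 at [x] covers one vertex; the others cost two edges each. *)
case: (@extend_closed_walk [set x] B x [::]) => //.
- by move=> y; rewrite !inE.
- by apply/set0Pn; exists x; rewrite set11.
- by rewrite sub1set.
rewrite cards1 /= => p [ep lp Bp sp].
have [|w [ew sw wE]] := cycle_of_path ep lp; first by lia.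
exists w; split=> //; last by lia.
by move=> y /Bp; rewrite wE.
Qed.

Lemma tsp_ub S B : cut_connected B -> S \subset B -> 1 < #|B| ->
  tsp e S <= 2 * #|B|.-1.
Proof.
move=> cB /subsetP SB /(closed_walk_cut_connected cB)[w [ew Bw <-]].
by apply: tsp_le ew _ => x /SB/Bw.
Qed.

(** Connectivity provides a closed walk through all vertices, so [tsp] does not take its default
    value 0 here. *)
Lemma tsp_spec S : cut_connected setT -> 1 < #|S| ->
  exists w, [/\ cycle e w, {subset S <= w} & size w = tsp e S].
Proof.
move=> cT lt1S.
have lt1T : 1 < #|[set: T]| by apply: leq_trans lt1S _; rewrite subset_leq_card.
have [w [ew Tw _]] := closed_walk_cut_connected cT lt1T.
by apply: (tsp_walk ew) => x _; apply: Tw.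
Qed.

Lemma tsp_ge_card S : cut_connected setT -> 1 < #|S| -> #|S| <= tsp e S.
Proof.
move=> cT /(tsp_spec cT)[w [_ Sw <-]].
by apply: leq_trans (card_size w); apply/subset_leq_card/subsetP.
Qed.

(** A closed walk with as many entries as [S] has vertices, covering [S], repeats nothing and never
    leaves [S]. For two vertices the cycle is an edge traversed back and forth. *)
Lemma tsp_hamiltonian S : cut_connected setT -> 1 < #|S| ->
  tsp e S = #|S| <-> hamiltonian_on e S.
Proof.
move=> cT lt1S; split=> [E|[s [us Ss es]]]; last first.
  apply/eqP; rewrite eqn_leq tsp_ge_card // andbT.
  rewrite (eq_card Ss) (card_uniqP us); apply: tsp_le => // x.
  by rewrite Ss.
have [w [ew Sw]] := tsp_spec cT lt1S; rewrite E => sw.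
have SE : S =i w.
  apply/subset_cardP; last exact/subsetP.
  apply/eqP; rewrite eqn_leq subset_leq_card; last exact/subsetP.
  by rewrite -sw card_size.
exists w; split=> //; apply/card_uniqP.
by rewrite sw (eq_card SE).
Qed.

End Tsp.

(** * Sums over the sets of size k between two given sets *)

Section KSum.
Variable T : finType.
Implicit Types (t : {set T} -> nat) (S V A : {set T}).

(** Peeling [u] either forces it into the sets ([V] grows) or forbids it ([A] shrinks), so the
    recursion stays within this family of sums. *)
Definition ksum k t V A :=
  \sum_(S : {set T} | [&& #|S| == k, V \subset S & S \subset A]) t S.

Lemma ksumD1 k t V A u : ksum k t V A = ksum k t (u |: V) A + ksum k t V (A :\ u).
Proof.
rewrite /ksum (bigID (fun S : {set T} => u \in S)) /=.
congr (_ + _); apply: eq_bigl => S.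
  by rewrite subUset sub1set; case: (_ == _); case: (u \in S); rewrite ?andbT ?andbF.
by rewrite subsetD1; case: (_ == _); case: (V \subset S).
Qed.

Lemma leq_ksum k t1 t2 V A :
  (forall S, #|S| = k -> V \subset S -> S \subset A -> t1 S <= t2 S) ->
  ksum k t1 V A <= ksum k t2 V A.
Proof. by move=> le12; apply: leq_sum => S /and3P[/eqP]; apply: le12. Qed.

Lemma ksum_const k c V A : ksum k (fun=> c) V A = c * ksum k (fun=> 1) V A.
Proof. by rewrite /ksum !sum_nat_const muln1 mulnC. Qed.

Lemma ksum_cards k A : ksum k (fun=> 1) set0 A = 'C(#|A|, k).
Proof.
rewrite /ksum sum1_card -cards_draws -sum1_card -sum1_card.
by apply: eq_bigl => S; rewrite inE unfold_in sub0set /= andbC.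
Qed.

Lemma ksum_cards1 k A v : v \in A -> ksum k.+1 (fun=> 1) [set v] A = 'C(#|A|.-1, k).
Proof.
move=> vA; have := ksumD1 k.+1 (fun=> 1) set0 A v.
rewrite setU0 !ksum_cards [#|A|](cardsD1 v) vA add1n binS /=; lia.
Qed.

Lemma ksum_cards2 k A u v : v \in A -> u \in A -> u != v ->
  ksum k.+2 (fun=> 1) (u |: [set v]) A = 'C(#|A|.-2, k).
Proof.
move=> vA uA uv; have := ksumD1 k.+2 (fun=> 1) [set v] A u.
rewrite !ksum_cards1 //; last by rewrite !inE eq_sym uv.
have : 1 < #|A| by apply/card_gt1P; exists u, v.
rewrite [#|A|](cardsD1 u) uA add1n /=; case: #|A :\ u| => //= m _; rewrite binS; lia.
Qed.

Lemma W_tsp_ksum (e : rel T) k : W_tsp e k = ksum k (tsp e) set0 setT.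
Proof. by rewrite /W_tsp /ksum; apply: eq_bigl => S; rewrite sub0set subsetT !andbT. Qed.

Lemma ksum_gt_card k t V A : #|A| < k -> ksum k t V A = 0.
Proof.
move=> ltA; apply: big_pred0 => S; apply/and3P=> -[/eqP cS _ /subset_leq_card].
lia.
Qed.

End KSum.

(** With [m] = |A| - 2, a cost of 2(|A| - 1) for each set through two fixed vertices becomes a
    multiple of the fixed factor 2(k + 1), ready for Pascal's rule. *)
Lemma mul_bin2 m k : 2 * m.+1 * 'C(m, k) = 2 * k.+1 * 'C(m.+1, k.+1).
Proof. by rewrite -!mulnA mul_bin_diag. Qed.

(** * The upper bound, and strictness with three non-cut vertices *)

Section UpperBound.
Variables (T : finType) (e : rel T).
Hypothesis esym : symmetric e.
Implicit Types (S A B : {set T}).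

Lemma ksum_tsp_ub2 k A u v : cut_connected e A -> v \in A -> u \in A -> u != v ->
  ksum k.+2 (tsp e) (u |: [set v]) A <= 2 * k.+1 * 'C(#|A|.-1, k.+1).
Proof.
move=> cA vA uA uv.
have lt1A : 1 < #|A| by apply/card_gt1P; exists u, v.
have -> : 2 * k.+1 * 'C(#|A|.-1, k.+1) = ksum k.+2 (fun=> 2 * #|A|.-1) (u |: [set v]) A.
  rewrite ksum_const ksum_cards2 //; case: #|A| lt1A => [|[|m]] //= _.
  by rewrite mul_bin2.
by apply: leq_ksum => S _ _ SA; apply: tsp_ub.
Qed.

(** The peeled vertex [u] differs from [v], so [v] survives into the induction; [ksum_tsp_ub2]
    handles the sets through [u]. *)
Lemma ksum_tsp_ub1 k A v : cut_connected e A -> v \in A ->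
  ksum k.+2 (tsp e) [set v] A <= 2 * k.+1 * 'C(#|A|, k.+2).
Proof.
have [m] := ubnP #|A|; elim: m A => // m IHm A ltA cA vA.
have [lt1A|le1A] := ltnP 1 #|A|; last by rewrite ksum_gt_card //; lia.
have [u [uA uv cu]] := noncut_vertex1 esym cA vA lt1A.
have := ksum_tsp_ub2 k cA vA uA uv.
have := IHm (A :\ u); rewrite (ksumD1 _ _ [set v] A u) !inE eq_sym uv vA.
move: ltA; rewrite [#|A|](cardsD1 u) uA add1n /= => ltA /(_ ltA cu isT).
by rewrite binS mulnDr; lia.
Qed.

(** The peeled vertex [u] becomes the fixed vertex of [ksum_tsp_ub1]; the sets avoiding it go by
    induction. *)
Lemma ksum_tsp_ub k A : cut_connected e A -> A != set0 ->
  ksum k.+2 (tsp e) set0 A <= 2 * k.+1 * 'C(#|A|.+1, k.+3).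
Proof.
have [m] := ubnP #|A|; elim: m A => // m IHm A ltA cA A0.
have [lt1A|le1A] := ltnP 1 #|A|; last by rewrite ksum_gt_card //; lia.
have /set0Pn[v vA] := A0.
have [u [uA uv cu]] := noncut_vertex1 esym cA vA lt1A.
have := ksum_tsp_ub1 k cA uA.
have := IHm (A :\ u); rewrite (ksumD1 _ _ set0 A u) setU0.
have -> : A :\ u != set0 by apply/set0Pn; exists v; rewrite !inE eq_sym uv.
move: ltA; rewrite [#|A|](cardsD1 u) uA add1n /= => ltA /(_ ltA cu isT).
by rewrite [in X in _ -> _ -> _ <= X]binS mulnDr; lia.
Qed.

(* If [u], [v] and [w] are non-cut vertices, a set containing [u] and [v] but not [w] has a
   tour inside [T \ w], so its term is not tight. *)
Lemma ksum_tsp_lt k (u v w : T) : cut_connected e setT ->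
  cut_connected e (setT :\ u) -> cut_connected e (setT :\ v) ->
  cut_connected e (setT :\ w) -> u != v -> w != u -> w != v -> k.+2 < #|T| ->
  W_tsp e k.+2 < 2 * k.+1 * 'C(#|T|.+1, k.+3).
Proof.
move=> cT cu cv cw uv wu wv ltk; rewrite W_tsp_ksum.
rewrite (ksumD1 _ _ _ _ v) setU0 (ksumD1 _ _ [set v] _ u).
have cardD x : #|[set: T] :\ x| = #|T|.-1.
  by rewrite -cardsT [in RHS](cardsD1 x) inE.
have B1 : ksum k.+2 (tsp e) set0 ([set: T] :\ v) <= 2 * k.+1 * 'C(#|T|, k.+3).
  have := @ksum_tsp_ub k ([set: T] :\ v) cv; rewrite cardD prednK; last by lia.
  by apply; apply/set0Pn; exists u; rewrite !inE uv.
have B2 : ksum k.+2 (tsp e) [set v] ([set: T] :\ u) <= 2 * k.+1 * 'C(#|T|.-1, k.+2).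
  by have := @ksum_tsp_ub1 k ([set: T] :\ u) v cu; rewrite cardD !inE eq_sym uv; apply.
(* The strict term: its sets are split again according to whether they contain [w]. *)
have B3 : ksum k.+2 (tsp e) (u |: [set v]) setT < 2 * k.+1 * 'C(#|T|.-1, k.+1).
  have le_w : ksum k.+2 (tsp e) (w |: (u |: [set v])) setT
      <= 2 * #|T|.-1 * ksum k.+2 (fun=> 1) (w |: (u |: [set v])) setT.
    rewrite -ksum_const; apply: leq_ksum => S _ _ _.
    by rewrite -cardsT tsp_ub ?subsetT // cardsT; lia.
  have le_nw : ksum k.+2 (tsp e) (u |: [set v]) (setT :\ w)
      <= 2 * #|T|.-2 * ksum k.+2 (fun=> 1) (u |: [set v]) (setT :\ w).
    rewrite -ksum_const; apply: leq_ksum => S _ _ Sw.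
    by rewrite -(cardD w) tsp_ub // cardD; lia.
  have := ksumD1 k.+2 (fun=> 1) (u |: [set v]) setT w.
  (* There are C(|T| - 3, k) such sets, a positive number because k + 2 < |T|. *)
  have nw_gt0 : 0 < ksum k.+2 (fun=> 1) (u |: [set v]) (setT :\ w).
    by rewrite ksum_cards2 ?inE // ?cardD ?bin_gt0 1?eq_sym //; lia.
  rewrite ksum_cards2 ?inE // cardsT => cE.
  have -> : 2 * k.+1 * 'C(#|T|.-1, k.+1) = 2 * #|T|.-1 * 'C(#|T|.-2, k).
    by case: #|T| ltk => [|[|m]] //= _; rewrite mul_bin2.
  rewrite (ksumD1 _ _ _ _ w) cE mulnDr.
  apply: leq_ltn_trans (leq_add le_w le_nw) _; rewrite ltn_add2l ltn_pmul2r //; lia.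
have -> : 'C(#|T|.+1, k.+3) = 'C(#|T|, k.+3) + ('C(#|T|.-1, k.+2) + 'C(#|T|.-1, k.+1)).
  rewrite binS; congr (_ + _).
  by rewrite -[in LHS](@prednK #|T|) ?binS //; lia.
by rewrite !mulnDr; lia.
Qed.

End UpperBound.

(** * Graphs with only two non-cut vertices are paths *)

Section PathRecognition.
Variables (T : finType) (e : rel T).
Hypotheses (esym : symmetric e) (eirr : irreflexive e).
Hypothesis ce : connected_graph e.

(* A simple path between two non-cut vertices spans [T], since a connected proper subset misses a
   non-cut vertex; the same applied to the path shortened along a chord shows it is induced. *)
Lemma two_noncut_path : 1 < #|T| ->
  (forall u v w, cut_connected e (setT :\ u) -> cut_connected e (setT :\ v) ->
    cut_connected e (setT :\ w) -> [|| u == v, w == u | w == v]) ->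
  is_path_graph e.
Proof.
move=> lt1T two; have cT := cut_connected_setT ce; have lt1s : 1 < #|[set: T]| by rewrite cardsT.
have /card_gt0P[x _] : 0 < #|T| by lia.
have [v [_ _ cv]] := noncut_vertex1 esym cT (in_setT x) lt1s.
have [u [_ uv cu]] := noncut_vertex1 esym cT (in_setT v) lt1s.
have full A : cut_connected e A -> v \in A -> u \in A -> A = setT.
  move=> cA vA uA; apply/eqP; case: eqVneq => // neq.
  have pA : A \proper setT by rewrite properEneq neq subsetT.
  have A0 : A != set0 by apply/set0Pn; exists v.
  have [w [_ wA cw]] := noncut_vertex esym cA A0 pA cT.
  have /or3P[] := two u v w cu cv cw; first by rewrite (negPf uv).
    by move/eqP=> wu; rewrite wu uA in wA.
  by move/eqP=> wv; rewrite wv vA in wA.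
have /connectP[p0 ep0] := ce v u.
case: (shortenP ep0) => p ep us _ uE.
pose s := v :: p.
have sT y : y \in s.
  have := full [set z in s] (cut_connected_path esym ep).
  rewrite ![_ \in finset _]inE mem_head {1}uE mem_last => /(_ isT isT)/setP/(_ y).
  by rewrite [LHS]inE [RHS]inE.
have szs : size s = #|T|.
  by rewrite -(card_uniqP us); apply: eq_card => y; rewrite sT.
have sorts : sorted e s by [].
have nochord i j : i.+1 < j -> j < size s -> ~~ e (nth v s i) (nth v s j).
  move=> ij js; apply/negP=> eij.
  have dE := drop_nth v js.
  have cA : cut_connected e [set z in take i.+1 s].
    by apply: cut_connected_path => //; have := take_sorted i.+1 sorts.
  have cB : cut_connected e [set z in drop j s].
    by rewrite dE; apply: cut_connected_path => //; have := drop_sorted j sorts; rewrite dE.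
  have sj : nth v s j \in [set z in drop j s] by rewrite dE !inE eqxx.
  have si : nth v s i \in [set z in take i.+1 s].
    by rewrite inE (take_nth v) ?mem_rcons ?inE ?eqxx //; lia.
  have := full _ (cut_connectedU esym cA cB si sj eij).
  rewrite !inE /= eqxx => /(_ isT); have -> : u \in drop j s.
    have : last v (take j s ++ drop j s) = u by rewrite cat_take_drop uE.
    by rewrite dE last_cat /= => <-; rewrite mem_last.
  rewrite orbT => /(_ isT)/(congr1 (fun A : {set T} => #|A|)); rewrite cardsT.
  have := leq_of_leqif (leq_card_setU [set z in take i.+1 s] [set z in drop j s]).
  have := card_size (take i.+1 s); have := card_size (drop j s).
  rewrite !cardsE size_drop size_takel; last by lia.
  by move=> h1 h2 h3 h4; have := leq_trans h3 (leq_add h2 h1); rewrite h4 -szs; lia.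
clearbody s; have index_s_inj y z : index y s = index z s -> y = z.
  by move/(congr1 (nth v s)); rewrite !nth_index.
have lt_s y : index y s < #|T| by rewrite -szs index_mem.
(* The isomorphism sends a vertex to its position on the spanning path. *)
exists (fun y => Ordinal (lt_s y)); split.
  apply: inj_card_bij; last by rewrite card_ord.
  by move=> y z /(congr1 val)/index_s_inj.
have adj y z : index y s < index z s -> e y z = ((index y s).+1 == index z s).
  move=> yz; have zs : index z s < size s by rewrite index_mem.
  case: eqVneq => [E|ne].
    have /(sortedP v) /(_ (index y s)) := sorts.
    by rewrite E !nth_index // => ->.
  have := nochord (index y s) (index z s); rewrite !nth_index // => nc.
  by apply/negbTE/nc => //; lia.
move=> y z; rewrite /Prel /=; case: (ltngtP (index y s) (index z s)) => [yz|zy|E].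
- by rewrite adj //; lia.
- by rewrite esym adj //; lia.
- by rewrite (index_s_inj _ _ E) eirr; lia.
Qed.

End PathRecognition.

(** * Tours of the whole vertex set: trees and cycles *)

Section SpanningTour.
Variables (T : finType) (e : rel T).

Lemma not_uniqP (w : seq T) : ~~ uniq w ->
  exists w1 x w2 w3, w = w1 ++ x :: w2 ++ x :: w3.
Proof.
elim: w => //= a w IHw; have [aw _|_ /IHw[w1 [x [w2 [w3 ->]]]]] := boolP (a \in w).
  by case/splitPr: aw => w2 w3; exists [::], a, w2, w3.
by exists (a :: w1), x, w2, w3.
Qed.

(* A closed walk repeating [x] splits into two closed walks sharing [x]. *)
Lemma acyclic_closed_walk (w : seq T) : acyclic e -> cycle e w ->
  2 * #|w|.-1 <= size w.
Proof.
move=> ace; have [m] := ubnP (size w); elim: m w => // m IHm w lew ew.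
(* Without repetition, acyclicity leaves at most two entries, and the bound is immediate. *)
have [uw|/not_uniqP[w1 [x [w2 [w3 wE]]]]] := boolP (uniq w).
  have := card_size w; have [/(ace _ uw)|] := ltnP 2 (size w); first by rewrite ew.
  by case: (size w) => [|[|[|]]]; case: #|w| => [|[|[|]]].
have : cycle e (x :: w2 ++ x :: (w3 ++ w1)).
  have -> : x :: w2 ++ x :: (w3 ++ w1) = (x :: w2 ++ x :: w3) ++ w1 by rewrite /= -catA.
  by rewrite -rot_size_cat rot_cycle -wE.
rewrite /= rcons_cat rcons_cons cat_path /= => /and3P[p2 e2 p3].
have e1 : cycle e (x :: w2) by rewrite /= rcons_path p2.
have e3 : cycle e (x :: (w3 ++ w1)) by [].
have sw : size w = size (x :: w2) + size (x :: (w3 ++ w1)).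
  by rewrite wE size_cat /= !size_cat /=; lia.
have := IHm _ _ e1; have := IHm _ _ e3.
(* The lengths of the two parts add up, while their vertex sets share [x], so |w| is at most the sum
   of their cardinals minus one. *)
have cE : #|w| = #|[set y in x :: w2] :|: [set y in x :: (w3 ++ w1)]|.
  apply: eq_card => y; rewrite wE !inE !mem_cat !inE !mem_cat !inE.
  by do !case: (_ \in _); rewrite ?orbT ?orbF //; case: (_ == _).
have := cardsUI [set y in x :: w2] [set y in x :: (w3 ++ w1)].
have : 0 < #|[set y in x :: w2] :&: [set y in x :: (w3 ++ w1)]|.
  by apply/card_gt0P; exists x; rewrite !inE eqxx.
rewrite -cE !cardsE; set c := #|w|; set c1 := #|x :: w2|; set c3 := #|_ :: (_ ++ _)|.
by move: sw lew => /=; lia.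
Qed.

Hypothesis esym : symmetric e.
Hypothesis cT : cut_connected e setT.

Lemma tsp_tree : acyclic e -> 1 < #|T| -> 2 * #|T|.-1 <= tsp e setT.
Proof.
move=> ace; rewrite -cardsT => lt1T.
have [w [ew Tw <-]] := tsp_spec esym cT lt1T.
have -> : #|[set: T]| = #|w| by apply: eq_card => x; rewrite Tw ?inE.
exact: acyclic_closed_walk.
Qed.

(** A cycle of length l covers l vertices with l edges; adding the others by detours gives a tour of
    length l + 2(n - l) = 2n - l, below 2n - 2 since l is at least 3. *)
Lemma tsp_cycle (s : seq T) : uniq s -> 3 <= size s -> cycle e s ->
  tsp e setT < 2 * #|T|.-1.
Proof.
case: s => // x p us les es.
have As : #|[set y in x :: p]| = (size p).+1 by rewrite cardsE (card_uniqP us).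
have [||p' [ep' lp' Tp' sp']] := extend_closed_walk (A := [set y in x :: p]) esym es
  (last_rcons _ _ _) _ _ (subsetT _) cT.
- by move=> y; rewrite !inE mem_rcons inE orbA orbb.
- by apply/set0Pn; exists x; rewrite !inE eqxx.
have := subset_leq_card (subsetT [set y in x :: p]).
rewrite As cardsT => leT.
have [|w [ew sw wE]] := cycle_of_path ep' lp'; first by rewrite sp' size_rcons.
have := tsp_le ew (S := setT); rewrite sw sp' As cardsT size_rcons => H.
move: les => /= les; apply: leq_ltn_trans (H _) _; first by move=> y /Tp'; rewrite wE.
by move: (#|T|) leT => n; lia.
Qed.

Lemma W_tsp_card : W_tsp e #|T| = tsp e setT.
Proof.
rewrite /W_tsp (big_pred1 setT) // => S.
by rewrite /= eqEcard subsetT cardsT eqn_leq max_card.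
Qed.

End SpanningTour.

(** * The matching lower bound on paths *)

Section PathLowerBound.
Variables (T : finType) (e : rel T) (f : T -> nat).
Hypothesis esym : symmetric e.
Hypothesis cT : cut_connected e setT.
Hypothesis f_inj : injective f.
Hypothesis f_lt : forall x, f x < #|T|.
Hypothesis f_edge : forall x y, e x y -> f y <= (f x).+1.

Lemma path_dist x p : path e x p ->
  f (last x p) <= f x + size p /\ f x <= f (last x p) + size p.
Proof.
elim: p x => [|y p IHp] x /=; first by lia.
case/andP=> exy /IHp; have := f_edge exy; rewrite esym in exy.
by have := f_edge exy; lia.
Qed.

(** Rotated to start at [x] and cut at [y], the tour consists of two arcs, each at least as long as
    the label difference. Truncated subtraction makes the case f y < f x trivial. *)
Lemma tsp_dist (S : {set T}) x y : x \in S -> y \in S -> 2 * (f y - f x) <= tsp e S.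
Proof.
move=> xS yS; have [->|neq] := eqVneq x y; first by lia.
have lt1S : 1 < #|S| by apply/card_gt1P; exists x, y.
have [w [ew Sw <-]] := tsp_spec esym cT lt1S.
have [i s wE] := rot_to (Sw x xS).
have : y \in rot i w by rewrite mem_rot Sw.
rewrite -(rot_cycle i) wE in ew; rewrite -(size_rot i) wE inE eq_sym (negPf neq) /= => ys.
move: ew; case/splitPr: ys => s1 s2 /=.
rewrite rcons_cat rcons_cons -cat_rcons cat_path last_rcons => /andP[].
move=> /path_dist[+ _] /path_dist[_ +].
by rewrite !last_rcons !size_rcons size_cat /=; lia.
Qed.

Lemma f_surj i : i < #|T| -> exists x, f x = i.
Proof.
move=> lti; pose g x := Ordinal (f_lt x).
have [|g' _ gK] := @inj_card_bij _ _ g _ (eq_leq (card_ord _)).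
  by move=> x y [] /f_inj.
by exists (g' (Ordinal lti)); have /(congr1 val) := gK (Ordinal lti).
Qed.

Definition label_interval i m := [set x | i <= f x < i + m].

Lemma label_intervalDr i m u : f u = i + m ->
  label_interval i m.+1 :\ u = label_interval i m.
Proof.
move=> fu; apply/setP=> x; rewrite !inE -(inj_eq f_inj) fu; lia.
Qed.

Lemma label_intervalDl i m v : f v = i ->
  label_interval i m.+1 :\ v = label_interval i.+1 m.
Proof.
move=> fv; apply/setP=> x; rewrite !inE -(inj_eq f_inj) fv; lia.
Qed.

Lemma card_label_interval i m : i + m <= #|T| -> #|label_interval i m| = m.
Proof.
elim: m => [_|m IHm le]; first by apply: eq_card0 => x; rewrite inE addn0; case: ltngtP.
have [|u fu] := @f_surj (i + m); first by lia.
rewrite (cardsD1 u) label_intervalDr // IHm; last by lia.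
by rewrite inE fu; lia.
Qed.

(** The recursion of [ksum_tsp_ub1], peeling the top label each time. *)
Lemma ksum_tsp_lb1 k i m v : i + m <= #|T| -> f v = i ->
  2 * k.+1 * 'C(m, k.+2) <= ksum k.+2 (tsp e) [set v] (label_interval i m).
Proof.
move=> le fv; elim: m le => [|m IHm] le; first by rewrite bin0n muln0.
have [->|m_gt0] := posnP m; first by rewrite bin_small ?muln0.
have [|u fu] := @f_surj (i + m); first by lia.
have uv : u != v by rewrite -(inj_eq f_inj); lia.
rewrite (ksumD1 _ _ _ _ u) label_intervalDr // binS mulnDr addnC.
apply: leq_add; last by apply: IHm; lia.
(* The labels of [v] and [u] differ by [m], one less than the size of the interval, so [tsp_dist]
   meets the bound of [tsp_ub]. *)
have -> : 2 * k.+1 * 'C(m, k.+1) =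
    ksum k.+2 (fun=> 2 * m) (u |: [set v]) (label_interval i m.+1).
  rewrite ksum_const ksum_cards2 //; try by rewrite inE; lia.
  by rewrite card_label_interval //; case: m m_gt0 {IHm le fu} => // m _; rewrite mul_bin2.
apply: leq_ksum => S _; rewrite subUset !sub1set => /andP[uS vS] _.
by apply: leq_trans (tsp_dist vS uS); lia.
Qed.

Lemma ksum_tsp_lb k i m : i + m <= #|T| ->
  2 * k.+1 * 'C(m.+1, k.+3) <= ksum k.+2 (tsp e) set0 (label_interval i m).
Proof.
elim: m i => [|m IHm] i le; first by rewrite bin_small ?muln0.
have [|v fv] := @f_surj i; first by lia.
rewrite (ksumD1 _ _ _ _ v) setU0 binS mulnDr addnC.
apply: leq_add; first exact: ksum_tsp_lb1.
by rewrite label_intervalDl //; apply: IHm; lia.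
Qed.

(** Stated for a labelling [f], so that it applies both to [Prel] itself and to any graph isomorphic
    to it. *)
Lemma W_tsp_lb k : 2 * k.+1 * 'C(#|T|.+1, k.+3) <= W_tsp e k.+2.
Proof.
rewrite W_tsp_ksum; have -> : setT = label_interval 0 #|T|.
  by apply/setP=> x; rewrite !inE f_lt.
exact: ksum_tsp_lb.
Qed.

End PathLowerBound.

(** * The path and the complete graph *)

Lemma Prel_sym n : symmetric (@Prel n).
Proof. by move=> x y; rewrite /Prel orbC. Qed.

Lemma Prel_connected n : connected_graph (@Prel n).
Proof.
have le_connect m (x y : 'I_n) : y = x + m :> nat -> connect (@Prel n) x y.
  elim: m y => [|m IHm] y yE.
    by rewrite (_ : y = x) ?connect0 //; apply: val_inj; rewrite /= yE addn0.
  have ltz : x + m < n by have := ltn_ord y; lia.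
  apply: (connect_trans (IHm (Ordinal ltz) erefl)); apply: connect1.
  by rewrite /Prel /= yE; lia.
move=> x y; have [xy|yx] := leqP x y.
  by apply: (@le_connect (y - x)); lia.
rewrite (sym_connect_sym (@Prel_sym n)).
by apply: (@le_connect (x - y)); lia.
Qed.

Lemma W_tsp_Prel_lb n k : 2 * k.+1 * 'C(n.+1, k.+3) <= W_tsp (@Prel n) k.+2.
Proof.
have := @W_tsp_lb 'I_n (@Prel n) val (@Prel_sym n)
  (cut_connected_setT (@Prel_connected n)) val_inj _ _ k.
rewrite card_ord; apply; first exact: ltn_ord.
by move=> x y; rewrite /Prel /=; lia.
Qed.

Lemma tsp_Krel n (S : {set 'I_n}) : 1 < #|S| -> tsp (@Krel n) S <= #|S|.
Proof.
move=> lt1S; rewrite cardE; apply: tsp_le => [|x]; last by rewrite mem_enum.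
have := enum_uniq S; move: lt1S; rewrite cardE.
case: (enum S) => // x p lt1p up; rewrite /= rcons_path.
(* Any enumeration of [S] is a cycle in the complete graph: distinct entries are adjacent, and the
   last differs from the first as there are at least two. *)
have := up; rewrite uniq_pairwise => /pairwise_sorted /= ->.
rewrite /Krel; apply: contraTneq up => lx.
by case: p lt1p lx => //= y p _ <-; rewrite mem_last.
Qed.

(** * Passage to averages and the final theorem *)

Lemma sum_draws_const (U : finType) k c :
  \sum_(S : {set U} | #|S| == k) c = c * 'C(#|U|, k).
Proof. by rewrite sum_nat_const mulnC -card_draws cardsE. Qed.

(** Follows from (n + 1) C(n, k + 2) = (k + 3) C(n + 1, k + 3). *)
Lemma path_bound_rat n k : k.+1 < n ->
  ((2 * (k.+2 - 1))%:R / (k.+2 + 1)%:R * (n + 1)%:R =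
    (2 * k.+1 * 'C(n.+1, k.+3))%:R / 'C(n, k.+2)%:R :> rat)%R.
Proof.
move=> ltk; have C0 : 'C(n, k.+2) != 0 by rewrite -lt0n bin_gt0.
rewrite mulrAC; apply/eqP.
rewrite eqr_div ?pnatr_eq0 ?addn1 // -!natrM eqr_nat subn1 /=; apply/eqP.
by rewrite -!mulnA mul_bin_diag [in RHS](mulnC 'C(_, _)).
Qed.

Theorem theorem5 (T : finType) (e : rel T) (k : nat) :
  simple_graph e -> connected_graph e -> 2 <= k -> k <= #|T| ->
  [/\ (k%:R <= mu_tsp e k :> rat)%R,
      (mu_tsp e k <= (2 * (k - 1))%:R / (k + 1)%:R * (#|T| + 1)%:R :> rat)%R,
      W_tsp (@Krel #|T|) k <= W_tsp e k <= W_tsp (@Prel #|T|) k,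
      (mu_tsp e k = (2 * (k - 1))%:R / (k + 1)%:R * (#|T| + 1)%:R :> rat)%R <->
        (is_path_graph e \/ (k = #|T| /\ is_tree e))
    & (mu_tsp e k = k%:R :> rat)%R <->
        (forall S : {set T}, #|S| = k -> hamiltonian_on e S)].
Proof.
(* From here on the k of the statement is [k.+2]. *)
case=> esym eirr ce; case: k => [|[|k]] // _ lek.
have cT := cut_connected_setT ce.
have cT_gt0 : 0 < #|[set: T]| by rewrite cardsT; lia.
have lt1 (S : {set T}) : #|S| = k.+2 -> 1 < #|S| by move=> ->.
have Wub : W_tsp e k.+2 <= 2 * k.+1 * 'C(#|T|.+1, k.+3).
  by rewrite W_tsp_ksum -cardsT; apply: ksum_tsp_ub; rewrite -?card_gt0.
have tsp_lb (S : {set T}) : #|S| == k.+2 -> k.+2 <= tsp e S.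
  by move/eqP=> cS; rewrite -cS tsp_ge_card // lt1.
have Wlb : k.+2 * 'C(#|T|, k.+2) <= W_tsp e k.+2 by rewrite -sum_draws_const; apply: leq_sum.
have C_gt0 : (0 < 'C(#|T|, k.+2)%:R :> rat)%R by rewrite ltr0n bin_gt0.
rewrite /mu_tsp path_bound_rat //; split.
- by rewrite ler_pdivlMr // -natrM ler_nat.
- by rewrite ler_pM2r ?invr_gt0 // ler_nat.
- apply/andP; split; last exact: leq_trans Wub (W_tsp_Prel_lb _ _).
  apply: leq_trans Wlb; rewrite -[#|T|]card_ord -sum_draws_const card_ord; apply: leq_sum => S /eqP cS.
  by rewrite -[leqRHS]cS; apply: tsp_Krel; rewrite cS.
- have -> : ((W_tsp e k.+2)%:R / 'C(#|T|, k.+2)%:R =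
      (2 * k.+1 * 'C(#|T|.+1, k.+3))%:R / 'C(#|T|, k.+2)%:R :> rat)%R <->
      W_tsp e k.+2 = 2 * k.+1 * 'C(#|T|.+1, k.+3).
    split=> [|-> //]; move/mulIf => H; apply/eqP; rewrite -(eqr_nat rat); apply/eqP.
    by apply: H; rewrite invr_eq0 lt0r_neq0.
  (* For k = n the bound on [W_tsp] reduces to 2(n - 1), the length of a doubled spanning tree. *)
  have tight_card : 2 * #|T|.-1 = 2 * (#|T|.-2).+1 * 'C(#|T|.+1, #|T|.+1).
    by rewrite binn muln1; lia.
  split=> [WE|[[f [[g fK gK] fE]]|[kE [_ ace]]]].
  + have [kE|ltk] : k.+2 = #|T| \/ k.+2 < #|T| by lia.
      right; split=> //; split=> // s us les; apply/negP=> es.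
      have := tsp_cycle esym cT us les es.
      by rewrite -W_tsp_card tight_card -kE WE -kE ltnn.
    left; apply: two_noncut_path => //; first by lia.
    move=> u v w cu cv cw; apply/negPn/negP; rewrite !negb_or => /and3P[uv wu wv].
    by have := ksum_tsp_lt esym cT cu cv cw uv wu wv ltk; rewrite WE ltnn.
  + apply/eqP; rewrite eqn_leq Wub; apply: (W_tsp_lb (f := val \o f)) => //.
    * exact: inj_comp val_inj (can_inj fK).
    * by move=> x; apply: ltn_ord.
    * by move=> x y; rewrite fE /Prel /=; lia.
  + apply/eqP; rewrite eqn_leq Wub kE W_tsp_card.
    have := tsp_tree esym cT ace; rewrite tight_card -kE /=.
    exact.
- have -> : ((W_tsp e k.+2)%:R / 'C(#|T|, k.+2)%:R = k.+2%:R :> rat)%R <->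
      W_tsp e k.+2 = k.+2 * 'C(#|T|, k.+2).
    split=> [E|->]; last by rewrite natrM mulfK ?lt0r_neq0.
    by apply/eqP; rewrite -(eqr_nat rat) natrM -E divfK // lt0r_neq0.
  split=> [WE S cS|ham].
    apply/(tsp_hamiltonian esym cT (lt1 S cS)); rewrite cS.
    (* Every summand is at least [k.+2], so equality of the sums forces equality in each term. *)
    have [_] := leqif_sum (fun S' cS' => leqif_eq (tsp_lb S' cS')).
    rewrite sum_draws_const -/(W_tsp e k.+2) WE eqxx => tight.
    have /forallP/(_ S) : is_true _ := Logic.eq_sym tight.
    by rewrite cS eqxx => /eqP.
  rewrite -sum_draws_const; apply: eq_bigr => S /eqP cS; rewrite -[RHS]cS.
  by apply/(tsp_hamiltonian esym cT (lt1 S cS))/ham.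
Qed.
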